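(* Suppose $u\in\mathbb{C}$ and $a\in\mathbb{N}$. (1) Let $1\le i\le n$. Then the operator $\mathcal{D}^{i\to i-1}_{u,a}:\mathcal{E}^i(\mathbb{R}^n)\to\mathcal{E}^{i-1}(\mathbb{R}^{n-1})$ vanishes if and only if $(u,a)=(n-2i,0)$ or $(u,i)=(-n-a,n)$. (2) Let $0\le i\le n-1$. Then the operator $\mathcal{D}^{i\to i}_{u,a}:\mathcal{E}^i(\mathbb{R}^n)\to\mathcal{E}^{i}(\mathbb{R}^{n-1})$ vanishes if and only if $(u,a)=(0,0)$ or $(u,i)=(-a,0)$.
   Context: $n\ge2$, $\mathbb{N}=\{0,1,2,\dots\}$; $\mathcal{E}^i$ denotes smooth complex-valued $i$-forms; $\mathbb{R}^{n-1}=\{x_n=0\}\subset\mathbb{R}^n$ and $\mathrm{Rest}_{x_n=0}$ is the pull-back of forms to this hyperplane. $\mathbb{R}^n$ has the standard flat metric, $d$ is the exterior derivative, $d^*$ the codifferential (formal adjoint of $d$, so on functions-times-forms $d^*(f\,dx_I)=-\sum_{\ell\in I}\partial_\ell f\;\iota_{\partial/\partial x_\ell}dx_I$), and $\iota_{\partial/\partial x_n}$ is interior multiplication. Scalar operators act coefficientwise on forms; $\Delta_{\mathbb{R}^{n-1}}=\sum_{j=1}^{n-1}\partial^2/\partial x_j^2$. For $\mu\in\mathbb{C}$, $\ell\in\mathbb{N}$ put $$\mathcal{D}^\mu_\ell=\sum_{k=0}^{[\ell/2]}\frac{2^{\ell-2k}}{k!(\ell-2k)!}\Big(\prod_{m=[(\ell+1)/2]}^{\ell-k-1}(\mu+m)\Big)\Delta_{\mathbb{R}^{n-1}}^k\Big(\frac{\partial}{\partial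 x_n}\Big)^{\ell-2k},$$ (empty product $=1$), which is the renormalized Gegenbauer polynomial $\widetilde C^\mu_\ell$ made homogeneous, $x^{\ell/2}\widetilde C_\ell^\mu(y/\sqrt{x})$, evaluated at $x=-\Delta_{\mathbb{R}^{n-1}}$, $y=\partial/\partial x_n$; and $\mathcal{D}^\mu_\ell=0$ for $\ell<0$. Put $\gamma(\mu,a)=1$ if $a$ is odd and $\gamma(\mu,a)=\mu+\frac a2$ if $a$ is even. With $\mu:=u+i-\frac{n-1}2$, define $$\mathcal{D}^{i\to i-1}_{u,a}=\mathrm{Rest}_{x_n=0}\circ\Big(-\mathcal{D}^{\mu+1}_{a-2}\,d\,d^*\iota_{\frac{\partial}{\partial x_n}}-\gamma(\mu,a)\mathcal{D}^{\mu+1}_{a-1}d^*+\tfrac12(u+2i-n)\mathcal{D}^\mu_a\iota_{\frac{\partial}{\partial x_n}}\Big)\quad(1\le i\le n),$$ $$\mathcal{D}^{i\to i}_{u,a}=\mathrm{Rest}_{x_n=0}\circ\Big(\mathcal{D}^{\mu+1}_{a-2}\,d\,d^*-\gamma(\mu-\tfrac12,a)\mathcal{D}^{\mu}_{a-1}d\,\iota_{\frac{\partial}{\partial x_n}}+\tfrac12(u+a)\mathcal{D}^\mu_a\Big)\quad(0\le i\le n-1).$$ *)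

(* Defs.v *)
From HB Require Import structures.
From mathcomp Require Import all_boot all_order all_algebra.
From mathcomp Require Import all_classical all_reals all_analysis.
From mathcomp Require Export complex.

Set Implicit Arguments.
Unset Strict Implicit.
Unset Printing Implicit Defensive.

Import Order.TTheory GRing.Theory Num.Theory.
Import numFieldNormedType.Exports.

Local Open Scope ring_scope.
Local Open Scope complex_scope.

Section Functions.
Variables (R : realType) (n : nat).

Definition rpartial (j : 'I_n) (f : 'rV[R]_n -> R) : 'rV[R]_n -> R :=
  fun x => 'D_(delta_mx 0 j) f x.

(* C^oo: all iterated partial derivatives, in any order, exist and are
   continuous. *)
Definition rsmooth (f : 'rV[R]_n -> R) : Prop :=
  forall s : seq 'I_n,
    continuous (foldr rpartial f s) /\
    forall (j : 'I_n) (x : 'rV[R]_n),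
      derivable (foldr rpartial f s) x (delta_mx 0 j).

Definition re_part (f : 'rV[R]_n -> R[i]) : 'rV[R]_n -> R :=
  fun x => complex.Re (f x).
Definition im_part (f : 'rV[R]_n -> R[i]) : 'rV[R]_n -> R :=
  fun x => complex.Im (f x).

Definition smooth (f : 'rV[R]_n -> R[i]) : Prop :=
  rsmooth (re_part f) /\ rsmooth (im_part f).

Definition partial (j : 'I_n) (f : 'rV[R]_n -> R[i]) : 'rV[R]_n -> R[i] :=
  fun x => rpartial j (re_part f) x +i* rpartial j (im_part f) x.

End Functions.

(* A complex-valued (inhomogeneous) differential form [w] on R^n is encoded by
   its coefficients: w = sum_I (w I) dx_I, over the subsets I of the index set,
   where dx_I is the wedge of the dx_j, j in I, in increasing order.
   Coordinates are numbered from 0. *)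
Notation diffform R n := ({set 'I_n} -> 'rV[R]_n -> R[i]) (only parsing).

Section Forms.
Variables (R : realType) (n : nat).
Implicit Types (w : diffform R n) (I : {set 'I_n}) (j : 'I_n).

Definition smooth_form (i : nat) (w : diffform R n) : Prop :=
  (forall I, smooth (w I)) /\ (forall I, #|I| != i -> w I = 0).

(* For j \notin I, dx_j /\ dx_I = wsign j I *: dx_(j |: I). *)
Definition wsign j I : R[i] := (-1) ^+ #|[set k in I | (k < j)%N]|.

Definition coefwise (P : ('rV[R]_n -> R[i]) -> ('rV[R]_n -> R[i]))
  (w : diffform R n) : diffform R n := fun I => P (w I).

(* w |-> dx_j /\ w *)
Definition wedge_dx j (w : diffform R n) : diffform R n :=
  fun I => if j \in I then wsign j I *: w (I :\ j) else 0.

Definition interior_mul j (w : diffform R n) : diffform R n :=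
  fun I => if j \in I then 0 else wsign j I *: w (j |: I).

Definition ext_d (w : diffform R n) : diffform R n :=
  \sum_(j < n) wedge_dx j (coefwise (partial j) w).

Definition codiff (w : diffform R n) : diffform R n :=
  - \sum_(j < n) interior_mul j (coefwise (partial j) w).

End Forms.

(* The ambient space is R^n with n = m.+1; the last coordinate x_n is
   [ord_max : 'I_m.+1], and [lift ord_max : 'I_m -> 'I_m.+1] is the
   value-preserving inclusion of the remaining coordinates. *)
Section Operators.
Variables (R : realType) (m : nat).
Local Notation n := m.+1.
Local Notation xn := (ord_max : 'I_n).

Definition hyperplane (y : 'rV[R]_m) : 'rV[R]_n :=
  \row_j (if unlift xn j is Some k then y 0 k else 0).

Definition Rest (w : diffform R n) : diffform R m :=
  fun J y => w [set lift xn k | k in J] (hyperplane y).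

Definition laplacian' (f : 'rV[R]_n -> R[i]) : 'rV[R]_n -> R[i] :=
  \sum_(k < m) partial (lift xn k) (partial (lift xn k) f).

Definition gegenbauer_nat (mu : R[i]) (l : nat) (f : 'rV[R]_n -> R[i]) :
    'rV[R]_n -> R[i] :=
  \sum_(0 <= k < (l./2).+1)
    (2 ^+ (l - k.*2) / (k`! * (l - k.*2)`!)%N%:R
      * \prod_((l.+1)./2 <= p < l - k) (mu + p%:R))
    *: iter k laplacian' (iter (l - k.*2) (partial xn) f).

(* The order [l] is an integer because the orders a - 1 and a - 2 used below can
   be negative, in which case the operator is 0 by convention. *)
Definition gegenbauer (mu : R[i]) (l : int) (w : diffform R n) : diffform R n :=
  match l with
  | Posz l => coefwise (gegenbauer_nat mu l) w
  | Negz _ => 0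
  end.

Definition gamma_coef (mu : R[i]) (a : nat) : R[i] :=
  if odd a then 1 else mu + a%:R / 2.

Definition mu_of (u : R[i]) (i : nat) : R[i] := u + i%:R - (n%:R - 1) / 2.

(* D^{i -> i-1}_{u,a} *)
Definition sbo_down (i : nat) (u : R[i]) (a : nat) (w : diffform R n) :
    diffform R m :=
  let mu := mu_of u i in
  Rest (- gegenbauer (mu + 1) (a%:Z - 2) (ext_d (codiff (interior_mul xn w)))
        - gamma_coef mu a *: gegenbauer (mu + 1) (a%:Z - 1) (codiff w)
        + ((u + 2 * i%:R - n%:R) / 2) *: gegenbauer mu a%:Z (interior_mul xn w)).

(* D^{i -> i}_{u,a} *)
Definition sbo_same (i : nat) (u : R[i]) (a : nat) (w : diffform R n) :
    diffform R m :=
  let mu := mu_of u i in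
  Rest (gegenbauer (mu + 1) (a%:Z - 2) (ext_d (codiff w))
        - gamma_coef (mu - 1 / 2) a *: gegenbauer mu (a%:Z - 1)
            (ext_d (interior_mul xn w))
        + ((u + a%:R) / 2) *: gegenbauer mu a%:Z w).

End Operators.

(* Main.v *)
Require Import Defs.
From mathcomp Require Import all_boot all_order all_algebra.
From mathcomp Require Import boolp classical_sets functions reals topology.
From mathcomp Require Import normedtype derive realfun ring zify.

(** Test each operator on forms with a single coefficient, [w = f dx_I], and
    call a wedge [dx_I] tangential when it does not contain [dx_n]. The
    coefficients of the restricted image then reduce to Gegenbauer operators
    applied to [f] and to its first and second derivatives: for instance
    [d d* (f dx_I)] has [dx_I]-coefficient minus the sum of [d_j d_j f] over
    [j] in [I] (lemma [ext_d_codiff_single]). The resulting formulas are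
    [sbo_down_normal], [sbo_down_tangential], [sbo_same_normal] and
    [sbo_same_tangential].

    The operators are not zero in general because a renormalized Gegenbauer
    polynomial has a coefficient that does not depend on its parameter: the one
    of the highest power of the tangential Laplacian, where the product over
    the [mu + p] is empty. The functions [x_k ^ (2 h) * x_n ^ q] with [q < 2]
    pick out exactly that coefficient at the origin ([gegenbauer_test]), so
    each choice of test form turns the vanishing of the operator into one
    affine equation on [u]. For order [a > 0] and forms that are neither of top
    degree (first family) nor functions (second family) these equations
    contradict one another ([nonvanishing_down], [nonvanishing_same]); the
    remaining degrees and the order [a = 0] give exactly the listed exceptions.

    Conversely, the exceptions are visible from the formulas, except for the
    forms of top degree. There the three terms have to be added up by the
    recurrence
    [D_(a-2)^(mu+1) Lap + gamma(mu, a) D_(a-1)^(mu+1) d_n = a/2 D_a^mu]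
    ([gegenbauer_three_term]), which makes the operator equal, up to sign, to
    [(u + n + a) / 2] times the restriction of [D_a^mu]. As an identity of
    operators the recurrence needs the derivation in [x_n] to commute with the
    tangential Laplacian, hence the symmetry of second derivatives
    ([rpartialC]). *)

Set Implicit Arguments.
Unset Strict Implicit.
Unset Printing Implicit Defensive.

Import Order.TTheory GRing.Theory Num.Theory.
Import numFieldNormedType.Exports.
Local Open Scope ring_scope.
Local Open Scope complex_scope.

(** * Calculus of smooth functions *)

Lemma dist_le_split (R : realFieldType) (a b p q e : R) :
  p = q -> `|a - q| < e / 2 -> `|b - p| < e / 2 -> `|a - b| <= e.
Proof.
move=> <- ap bp; apply: le_trans (ler_distD p _ _) _.
by rewrite (splitr e) ltW // ltrD // distrC.
Qed.

Section RealCalculus.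
Variables (R : realType) (n : nat).
Implicit Types (f g : 'rV[R]_n -> R) (j k : 'I_n).

Lemma rsmooth_continuous f : rsmooth f -> continuous f.
Proof. by move=> sf; have [] := sf [::]. Qed.

Lemma rsmooth_derivable f j x : rsmooth f -> derivable f x (delta_mx 0 j).
Proof. by move=> sf; have [_] := sf [::]; apply. Qed.

Lemma rsmooth_rpartial f j : rsmooth f -> rsmooth (rpartial j f).
Proof. by move=> sf s; have := sf (rcons s j); rewrite foldr_rcons. Qed.

Lemma rpartial_lin (c d : R) f g j : rsmooth f -> rsmooth g ->
  rpartial j (c *: f + d *: g) = c *: rpartial j f + d *: rpartial j g.
Proof.
move=> sf sg; apply/funext => x; rewrite /rpartial.
have df := @rsmooth_derivable f j x sf; have dg := @rsmooth_derivable g j x sg.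
rewrite deriveD; [|exact: derivableZ..].
by rewrite !deriveZ.
Qed.

Lemma rsmooth_lin (c d : R) f g :
  rsmooth f -> rsmooth g -> rsmooth (c *: f + d *: g).
Proof.
move=> sf sg s.
have -> : foldr (@rpartial R n) (c *: f + d *: g) s
    = c *: foldr (@rpartial R n) f s + d *: foldr (@rpartial R n) g s.
  elim: s => //= j s ->; apply: rpartial_lin => t; rewrite -foldr_cat.
    exact: sf.
  exact: sg.
have [cf df] := sf s; have [cg dg] := sg s; split=> [x|j x].
  apply: continuousD; apply: continuousZ; try exact: cst_continuous.
    exact: cf.
  exact: cg.
by apply: derivableD; apply: derivableZ; [exact: df|exact: dg].
Qed.

Lemma rpartialB f g j : rsmooth f -> rsmooth g ->
  rpartial j (f - g) = rpartial j f - rpartial j g.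
Proof.
move=> sf sg; have := rpartial_lin 1 (- 1) j sf sg.
by rewrite !scaleN1r !scale1r.
Qed.

Lemma rsmoothB f g : rsmooth f -> rsmooth g -> rsmooth (f - g).
Proof.
by move=> sf sg; have := rsmooth_lin 1 (- 1) sf sg; rewrite scaleN1r scale1r.
Qed.

Lemma is_derive_line f (x v : 'rV[R]_n) (s : R) :
  derivable f (x + s *: v) v ->
  is_derive s (1 : R) (fun t : R => f (x + t *: v)) ('D_v f (x + s *: v)).
Proof.
move=> df.
have E : (fun h : R => h^-1 *: (((fun t : R => f (x + t *: v)) \o shift s)
      (h *: 1) - f (x + s *: v)))
  = (fun h => h^-1 *: ((f \o shift (x + s *: v)) (h *: v) - f (x + s *: v))).
  apply/funext => h /=; congr (_ *: (f _ - _)).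
  have -> : h *: (1 : R) = h by rewrite /GRing.scale/= mulr1.
  by rewrite scalerDl addrCA.
by split; rewrite /derivable /derive E.
Qed.

(** The one-variable mean value theorem along a coordinate line; smoothness only
    provides derivatives in the coordinate directions. *)
Lemma rsmooth_MVT f j (x : 'rV[R]_n) (h : R) : 0 < h -> rsmooth f ->
  exists2 s, 0 < s < h &
    f (x + h *: delta_mx 0 j) - f x = rpartial j f (x + s *: delta_mx 0 j) * h.
Proof.
move=> h0 sf.
have D t : is_derive t (1 : R) (fun t => f (x + t *: delta_mx 0 j))
    (rpartial j f (x + t *: delta_mx 0 j)).
  by apply: is_derive_line; exact: rsmooth_derivable.
have [] := @MVT R _ _ 0 h h0 (fun t _ => D t).
  apply: derivable_within_continuous => t _.
  by case: (D t).
move=> s; rewrite in_itv /= scale0r addr0 subr0 => s01 e.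
by exists s.
Qed.

Lemma rpartial_shift f (v : 'rV[R]_n) j :
  rpartial j (fun x => f (x + v)) = (fun x => rpartial j f (x + v)).
Proof.
apply/funext => x; rewrite /rpartial /derive.
suff -> : (fun h : R => h^-1 *: (((fun x => f (x + v)) \o shift x)
      (h *: delta_mx 0 j) - f (x + v)))
  = (fun h => h^-1 *: ((f \o shift (x + v)) (h *: delta_mx 0 j) - f (x + v))).
  by [].
by apply/funext => h /=; rewrite addrA.
Qed.

Lemma derivable_shift f (v x w : 'rV[R]_n) :
  derivable f (x + v) w -> derivable (fun x => f (x + v)) x w.
Proof.
rewrite /derivable.
suff -> : (fun h : R => h^-1 *: (((fun x => f (x + v)) \o shift x)
      (h *: w) - f (x + v)))
  = (fun h => h^-1 *: ((f \o shift (x + v)) (h *: w) - f (x + v))).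
  by [].
by apply/funext => h /=; rewrite addrA.
Qed.

Lemma rsmooth_shift f (v : 'rV[R]_n) :
  rsmooth f -> rsmooth (fun x => f (x + v)).
Proof.
move=> sf s.
have -> : foldr (@rpartial R n) (fun x => f (x + v)) s
    = (fun x => foldr (@rpartial R n) f s (x + v)).
  by elim: s => //= j s ->; rewrite rpartial_shift.
have [cf df] := sf s; split=> [x|j x]; last exact/derivable_shift/df.
have cs : {for x, continuous (fun x : 'rV[R]_n => x + v)}.
  by apply: continuousD; [exact: cvg_id | exact: cst_continuous].
exact: (continuous_comp cs (cf _)).
Qed.

(** Two applications of the mean value theorem, first along [j] to the increment
    of [f] in the direction [k], then along [k]. The left-hand side is symmetric
    in [j] and [k], which is what makes the mixed derivatives agree. *)
Lemma second_difference f j k (x : 'rV[R]_n) (h : R) : 0 < h -> rsmooth f ->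
  exists s t, [/\ 0 < s < h, 0 < t < h &
    f (x + h *: delta_mx 0 j + h *: delta_mx 0 k) - f (x + h *: delta_mx 0 j)
    - f (x + h *: delta_mx 0 k) + f x
    = rpartial k (rpartial j f) (x + s *: delta_mx 0 j + t *: delta_mx 0 k)
      * h ^+ 2].
Proof.
move=> h0 sf.
pose g := (fun x => f (x + h *: delta_mx 0 k)) - f.
have sfk := rsmooth_shift (h *: delta_mx 0 k) sf.
have sg : rsmooth g by exact: rsmoothB.
have [s s0h e1] := @rsmooth_MVT g j x h h0 sg.
have [t t0h e2] := @rsmooth_MVT (rpartial j f) k (x + s *: delta_mx 0 j) h h0
  (rsmooth_rpartial j sf).
exists s, t; split=> //.
rewrite expr2 mulrA -e2.
have -> : rpartial j f (x + s *: delta_mx 0 j + h *: delta_mx 0 k)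
  - rpartial j f (x + s *: delta_mx 0 j) = rpartial j g (x + s *: delta_mx 0 j).
  by rewrite /g (rpartialB _ sfk sf) rpartial_shift.
rewrite -e1.
have gE y : g y = f (y + h *: delta_mx 0 k) - f y by [].
by rewrite !gE opprB addrA [RHS]addrAC.
Qed.

(** Schwarz's theorem: the second differences in the two orders coincide, so the
    two mixed derivatives take a common value at points arbitrarily near [x],
    and both are continuous. *)
Lemma rpartialC f j k : rsmooth f ->
  rpartial j (rpartial k f) = rpartial k (rpartial j f).
Proof.
move=> sf; apply/funext => x.
have cjk := rsmooth_continuous (rsmooth_rpartial j (rsmooth_rpartial k sf)).
have ckj := rsmooth_continuous (rsmooth_rpartial k (rsmooth_rpartial j sf)).
apply/eqP; rewrite -subr_eq0 -normr_le0; apply/ler_addgt0Pl => e e0.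
rewrite addr0.
have e2 : 0 < e / 2 by rewrite divr_gt0.
have /cvgrPdist_lt /(_ _ e2) /nbhs_ballP[d1 /= d10 B1] := cjk x.
have /cvgrPdist_lt /(_ _ e2) /nbhs_ballP[d2 /= d20 B2] := ckj x.
have m0 : 0 < Num.min d1 d2 by rewrite lt_min d10 d20.
have [h h0 hh] : exists2 h : R, 0 < h & h + h = Num.min d1 d2.
  by exists (Num.min d1 d2 / 2); [rewrite divr_gt0 | rewrite -splitr].
(* Both intermediate points lie within [2 h], so in both continuity balls. *)
have small (s t : R) (a b : 'I_n) : 0 < s < h -> 0 < t < h ->
    `|x - (x + s *: delta_mx 0 a + t *: delta_mx 0 b)| < Num.min d1 d2.
  move=> /andP[s0 sh] /andP[t0 th].
  rewrite opprD addrA opprD addrA subrr sub0r -opprD normrN.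
  apply: le_lt_trans (ler_normD _ _) _.
  have nd (c : 'I_n) : `|delta_mx 0 c : 'rV[R]_n| <= 1.
    rewrite /Num.Def.normr/= mx_normrE; apply: bigmax_le => //= i _.
    by rewrite mxE; case: (_ && _); rewrite ?normr1 ?normr0.
  rewrite !normrZ (gtr0_norm s0) (gtr0_norm t0).
  have sa := ler_wpM2l (ltW s0) (nd a); have tb := ler_wpM2l (ltW t0) (nd b).
  rewrite !mulr1 in sa tb.
  rewrite -hh.
  by apply: ltrD; [exact: le_lt_trans sa sh | exact: le_lt_trans tb th].
have [s [t [s0 t0 E1]]] := second_difference j k x h0 sf.
have [s' [t' [s'0 t'0 E2]]] := second_difference k j x h0 sf.
have E : rpartial k (rpartial j f) (x + s *: delta_mx 0 j + t *: delta_mx 0 k)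
  = rpartial j (rpartial k f) (x + s' *: delta_mx 0 k + t' *: delta_mx 0 j).
  apply: (@mulIf _ (h ^+ 2)); first by rewrite expf_neq0 // gt_eqF.
  apply: etrans (esym E1) (etrans _ E2).
  by rewrite (addrAC x) (addrAC (f _)).
have {}B1 := B1 (x + s' *: delta_mx 0 k + t' *: delta_mx 0 j).
have {}B2 := B2 (x + s *: delta_mx 0 j + t *: delta_mx 0 k).
rewrite -ball_normE /ball_ /= in B1 B2.
have := small s' t' k j s'0 t'0; rewrite lt_min => /andP[/B1 {}B1 _].
have := small s t j k s0 t0; rewrite lt_min => /andP[_ /B2 {}B2].
exact: dist_le_split E B1 B2.
Qed.

End RealCalculus.

Section ComplexCalculus.
Variables (R : realType) (n : nat).
Implicit Types (f g : 'rV[R]_n -> R[i]) (j k : 'I_n).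

(** The outer factors [1] put the right-hand side in the shape to which
    [rpartial_lin] applies twice. *)
Lemma re_part_lin (c : R[i]) f g : re_part (c *: f + g) =
  1 *: (complex.Re c *: re_part f + (- complex.Im c) *: im_part f)
  + 1 *: re_part g.
Proof.
apply/funext => x; rewrite /re_part /im_part !fctE !scale1r scaleNr.
by case: c (f x) (g x) => a b [u v] [s t].
Qed.

Lemma im_part_lin (c : R[i]) f g : im_part (c *: f + g) =
  1 *: (complex.Re c *: im_part f + complex.Im c *: re_part f)
  + 1 *: im_part g.
Proof.
apply/funext => x; rewrite /re_part /im_part !fctE !scale1r.
by case: c (f x) (g x) => a b [u v] [s t].
Qed.

Lemma smooth_lin (c : R[i]) f g : smooth f -> smooth g -> smooth (c *: f + g).
Proof.
move=> [rf jf] [rg jg].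
split; [rewrite re_part_lin | rewrite im_part_lin].
- exact: (rsmooth_lin 1 1 (rsmooth_lin (complex.Re c) (- complex.Im c) rf jf) rg).
- exact: (rsmooth_lin 1 1 (rsmooth_lin (complex.Re c) (complex.Im c) jf rf) jg).
Qed.

Lemma partial_lin (c : R[i]) f g j : smooth f -> smooth g ->
  partial j (c *: f + g) = c *: partial j f + partial j g.
Proof.
move=> [rf jf] [rg jg]; apply/funext => x.
rewrite /partial re_part_lin im_part_lin.
have sre := rsmooth_lin (complex.Re c) (- complex.Im c) rf jf.
have sim := rsmooth_lin (complex.Re c) (complex.Im c) jf rf.
rewrite (rpartial_lin 1 1 j sre rg) (rpartial_lin 1 1 j sim jg).
rewrite (rpartial_lin _ _ j rf jf) (rpartial_lin _ _ j jf rf).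
rewrite !fctE !scale1r scaleNr.
move: (rpartial j (re_part f) x) (rpartial j (re_part g) x)
  (rpartial j (im_part f) x) (rpartial j (im_part g) x) => u s v t.
by clear; case: c.
Qed.

Lemma re_part_partial f j : re_part (partial j f) = rpartial j (re_part f).
Proof. by []. Qed.

Lemma im_part_partial f j : im_part (partial j f) = rpartial j (im_part f).
Proof. by []. Qed.

Lemma smooth_partial f j : smooth f -> smooth (partial j f).
Proof.
move=> [rf jf]; split.
- exact: (rsmooth_rpartial j rf).
- exact: (rsmooth_rpartial j jf).
Qed.

Lemma partialC f j k : smooth f ->
  partial j (partial k f) = partial k (partial j f).
Proof.
move=> [rf jf]; rewrite /partial -/(partial k f) -/(partial j f).
rewrite !re_part_partial !im_part_partial.
by rewrite (rpartialC j k rf) (rpartialC j k jf).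
Qed.

Lemma partial0 j : partial j 0 = 0 :> ('rV[R]_n -> R[i]).
Proof.
have re0 : re_part 0 = cst 0 :> ('rV[R]_n -> R) by [].
have im0 : im_part 0 = cst 0 :> ('rV[R]_n -> R) by [].
have d0 x : rpartial j (cst 0 : 'rV[R]_n -> R) x = 0 by exact: derive_cst.
by apply/funext => x; rewrite /partial re0 im0 !d0.
Qed.

Lemma smooth0 : smooth (0 : 'rV[R]_n -> R[i]).
Proof.
have s0 : rsmooth (fun _ : 'rV[R]_n => 0 : R).
  move=> s; have -> : foldr (@rpartial R n) (fun _ => 0) s = cst 0.
    by elim: s => //= j s ->; apply/funext => x; exact: derive_cst.
  by split=> [|j x]; [exact: cst_continuous | exact: derivable_cst].
by split; exact: s0.
Qed.

Lemma smoothZ c f : smooth f -> smooth (c *: f).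
Proof. by move=> sf; rewrite -[_ *: _]addr0; apply: smooth_lin smooth0. Qed.

Lemma partialZ c f j : smooth f -> partial j (c *: f) = c *: partial j f.
Proof.
move=> sf; rewrite -[c *: f]addr0 (partial_lin _ _ sf smooth0).
by rewrite partial0 addr0.
Qed.

Lemma smoothD f g : smooth f -> smooth g -> smooth (f + g).
Proof. by move=> sf sg; rewrite -[f]scale1r; apply: smooth_lin. Qed.

Lemma partialD f g j : smooth f -> smooth g ->
  partial j (f + g) = partial j f + partial j g.
Proof.
by move=> sf sg; rewrite -[f in LHS]scale1r partial_lin // scale1r.
Qed.

Lemma smooth_sum (I : Type) (r : seq I) (P : pred I)
    (F : I -> 'rV[R]_n -> R[i]) :
  (forall i, smooth (F i)) -> smooth (\sum_(i <- r | P i) F i).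
Proof.
by move=> sF; apply: (big_ind (@smooth R n)) => [|f g|i _];
  [exact: smooth0 | exact: smoothD | exact: sF].
Qed.

Lemma partial_sum (I : Type) (r : seq I) (P : pred I)
    (F : I -> 'rV[R]_n -> R[i]) j :
  (forall i, smooth (F i)) ->
  partial j (\sum_(i <- r | P i) F i) = \sum_(i <- r | P i) partial j (F i).
Proof.
move=> sF; elim: r => [|i r IH]; first by rewrite !big_nil partial0.
rewrite !big_cons; case: (P i) => //.
by rewrite (partialD j (sF i) (smooth_sum r P sF)) IH.
Qed.

End ComplexCalculus.

(** * Monomials in two coordinates *)

Section Monomials.
Local Open Scope classical_set_scope.
Variables (R : realType) (n : nat) (k l : 'I_n).
Hypothesis neq_kl : k != l.

Lemma is_derive_coord (j : 'I_n) (x v : 'rV[R]_n) :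
  is_derive x v (fun y : 'rV[R]_n => y 0 j) (v 0 j).
Proof.
have L : (fun h : R => h^-1 *: (((fun y : 'rV[R]_n => y 0 j) \o shift x) (h *: v)
    - x 0 j)) @ 0^' --> v 0 j.
  apply: cvg_near_cst; near=> h.
  have h0 : h != 0 by near: h; exact: nbhs_dnbhs_neq.
  by rewrite /= !mxE addrK /GRing.scale/= mulrA mulVf // mul1r.
by split; [apply/cvg_ex; exists (v 0 j) | exact: cvg_lim L].
Unshelve. all: by end_near.
Qed.

Definition rmonomial (p q : nat) : 'rV[R]_n -> R :=
  fun x => x 0 k ^+ p * x 0 l ^+ q.

Lemma is_derive_rmonomial p q (x v : 'rV[R]_n) : is_derive x v (rmonomial p q)
  (v 0 k * p%:R * rmonomial p.-1 q x + v 0 l * q%:R * rmonomial p q.-1 x).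
Proof.
have -> : rmonomial p q = ((fun y : 'rV[R]_n => y 0 k) ^+ p)
      * (fun y : 'rV[R]_n => y 0 l) ^+ q.
  by rewrite !fctE.
have dk := is_deriveX p (is_derive_coord k x v).
have dl := is_deriveX q (is_derive_coord l x v).
apply: is_derive_eq (is_deriveM dk dl) _.
rewrite !exprfctE /rmonomial /GRing.scale /=; ring.
Qed.

Lemma rpartial_rmonomial p q j : rpartial j (rmonomial p q)
  = if j == k then p%:R *: rmonomial p.-1 q
    else if j == l then q%:R *: rmonomial p q.-1 else 0.
Proof.
apply/funext => x; rewrite /rpartial.
have [_ ->] := is_derive_rmonomial p q x (delta_mx 0 j).
rewrite !mxE eqxx /= ![_ == j]eq_sym.
case: eqP => [->|_]; first by rewrite (negPf neq_kl) !mul0r addr0 mul1r.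
by case: eqP => _; rewrite !mul0r add0r // mul1r.
Qed.

(** Monomials form, up to scalars, a family stable under all partial derivatives,
    so that continuity and differentiability of its members is enough. *)
Lemma rsmooth_rmonomial p q : rsmooth (rmonomial p q).
Proof.
have dm (c : R) p' q' (x v : 'rV[R]_n) : derivable (c *: rmonomial p' q') x v.
  by apply: derivableZ; have [] := is_derive_rmonomial p' q' x v.
move=> s.
have [c [p' [q' ->]]] : exists c p' q',
    foldr (@rpartial R n) (rmonomial p q) s = c *: rmonomial p' q'.
  elim: s => [|j s [c [p' [q' E]]]]; first by exists 1, p, q; rewrite scale1r.
  have [d [p2 [q2 E2]]] : exists d p2 q2,
      rpartial j (rmonomial p' q') = d *: rmonomial p2 q2.
    rewrite rpartial_rmonomial; case: eqP => _; first by eexists _, _, _.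
    case: eqP => _; first by eexists _, _, _.
    by exists 0, 0%N, 0%N; rewrite scale0r.
  exists (c * d), p2, q2; rewrite -scalerA -E2 /= E.
  apply/funext => x; rewrite /rpartial deriveZ //.
  by have [] := is_derive_rmonomial p' q' x (delta_mx 0 j).
split=> [x|j x]; last exact: dm.
have cc (j : 'I_n) : {for x, continuous (fun y : 'rV[R]_n => y 0 j)}.
  exact: differentiable_continuous (differentiable_coord _ _ _).
apply: continuousZ; first exact: cst_continuous.
exact: (continuousM (continuous_comp (cc k) (@exprn_continuous R p' (x 0 k)))
  (continuous_comp (cc l) (@exprn_continuous R q' (x 0 l)))).
Qed.

Definition monomial (p q : nat) : 'rV[R]_n -> R[i] :=
  fun x => (rmonomial p q x)%:C.

Lemma smooth_monomial p q : smooth (monomial p q).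
Proof. by split; [exact: rsmooth_rmonomial | have [_] := @smooth0 R n]. Qed.

Lemma partial_monomial p q j : partial j (monomial p q)
  = if j == k then p%:R *: monomial p.-1 q
    else if j == l then q%:R *: monomial p q.-1 else 0.
Proof.
have rC (r : nat) (s : R) : (r%:R * s)%:C = r%:R * s%:C.
  by rewrite rmorphM rmorph_nat.
apply/funext => x; rewrite /partial.
have -> : rpartial j (im_part (monomial p q)) x = 0 by exact: derive_cst.
rewrite [re_part _]/(rmonomial p q) rpartial_rmonomial.
case: eqP => _; first exact: rC.
by case: eqP => _ //; exact: rC.
Qed.

Lemma monomial_at0 p q : monomial p q 0 = ((p == 0%N) && (q == 0%N))%:R.
Proof.
rewrite /monomial /rmonomial !mxE !expr0n.
by case: (p == 0%N) (q == 0%N) => [] []; rewrite ?mulr1 ?mulr0.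
Qed.

End Monomials.

Local Opaque partial smooth.

(** * Gegenbauer operators *)

Section GegenbauerCoefficients.
Variable C : numFieldType.
Implicit Types (mu : C) (l k r : nat).

Definition gegen_coef mu l k : C :=
  2 ^+ (l - k.*2) / (k`! * (l - k.*2)`!)%N%:R
    * \prod_((l.+1)./2 <= p < l - k) (mu + p%:R).

(** Writing the order as [2 k + r], with [r] the power of the normal derivative,
    removes all truncated subtractions. *)
Lemma gegen_coefE mu r k : gegen_coef mu (k.*2 + r) k =
  2 ^+ r / (k`!%:R * r`!%:R)
    * \prod_(k + uphalf r <= p < k + r) (mu + p%:R).
Proof.
rewrite /gegen_coef addKn natrM; congr (_ * _).
rewrite -[((k.*2 + r).+1)./2]/(uphalf (k.*2 + r)) uphalfE -addnS halfD.
rewrite odd_double add0n doubleK -uphalfE.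
by have -> : (k.*2 + r - k = k + r)%N by lia.
Qed.

Lemma prod_shift mu (s t : nat) :
  \prod_(s <= p < t) (mu + 1 + p%:R) = \prod_(s.+1 <= p < t.+1) (mu + p%:R) :> C.
Proof.
rewrite big_add1 /=; apply: eq_bigr => p _.
by rewrite -addrA -nat1r.
Qed.

Lemma factR_neq0 r : r`!%:R != 0 :> C.
Proof. by rewrite pnatr_eq0 -lt0n fact_gt0. Qed.

(** Raising [mu] by one shifts the product by one place, which matches the shift
    of both of its bounds when the order grows by two and [k] by one. *)
Lemma gegen_coef_up2 mu r k :
  gegen_coef (mu + 1) (k.*2 + r) k = k.+1%:R * gegen_coef mu (k.*2 + r).+2 k.+1.
Proof.
rewrite -[(k.*2 + r).+2]/(k.+1.*2 + r)%N !gegen_coefE prod_shift factS natrM.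
have kf := factR_neq0 k; have rf := factR_neq0 r.
have k1 : k.+1%:R != 0 :> C by rewrite pnatr_eq0.
rewrite mulrA; congr (_ * _).
move: (k.+1%:R : C) k1 => c c0.
by field; rewrite kf rf c0.
Qed.

(** The scalar is [gamma_coef mu a] for the order [a = 2 k + r + 1]: for even
    [a] it supplies the lowest factor [mu + a / 2] that the shifted product has
    lost, and for odd [a] no factor is lost. *)
Lemma gegen_coef_up1 mu r k :
  (if odd r.+1 then 1 else mu + (k.*2 + r.+1)%:R / 2)
    * gegen_coef (mu + 1) (k.*2 + r) k
  = r.+1%:R / 2 * gegen_coef mu (k.*2 + r.+1) k.
Proof.
rewrite !gegen_coefE prod_shift factS natrM exprS.
have kf := factR_neq0 k; have rf := factR_neq0 r.
have r1 : r.+1%:R != 0 :> C by rewrite pnatr_eq0.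
have two : (2 : C) != 0 by rewrite pnatr_eq0.
set P := \prod_(_ <= _ < _) _; set Q := (X in _ = _ * (_ * X)).
have -> : Q = (if odd r.+1 then 1 else mu + (k.*2 + r.+1)%:R / 2) * P.
  rewrite /Q /P /=; have [ro|re] := boolP (odd r).
    have [s rE] : exists s, r = s.*2.+1 by exists r./2; lia.
    rewrite big_ltn; last by lia.
    have -> : (k + uphalf r.+1 = k + s.+1)%N by lia.
    have -> : (k + uphalf r = k + s.+1)%N by lia.
    rewrite -!addnS; congr (_ * _); congr (_ + _).
    by apply: (mulIf two); rewrite divfK // -natrM; congr _%:R; lia.
  by rewrite /= mul1r -addnS; congr (\prod_(_ <= _ < _) _); lia.
set g := (if _ then _ else _).
move: (r.+1%:R : C) r1 => c c0.
by field; rewrite kf rf c0.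
Qed.

End GegenbauerCoefficients.

Section Gegenbauer.
Variables (R : realType) (m : nat).
Local Notation n := m.+1.
Local Notation xn := (ord_max : 'I_n).
Local Notation lap := (@laplacian' R m).
Implicit Types (f g : 'rV[R]_n -> R[i]) (mu c : R[i]).

Lemma gegenbauer_natE mu l f : gegenbauer_nat mu l f =
  \sum_(0 <= k < (l./2).+1)
    gegen_coef mu l k *: iter k lap (iter (l - k.*2) (partial xn) f).
Proof. reflexivity. Qed.

Lemma smooth_laplacian f : smooth f -> smooth (lap f).
Proof.
move=> sf; rewrite /laplacian'; apply: (smooth_sum (index_enum _) predT) => k.
exact: smooth_partial _ (smooth_partial _ sf).
Qed.

Lemma laplacianZ c f : smooth f -> lap (c *: f) = c *: lap f.
Proof.
move=> sf; rewrite /laplacian' scaler_sumr; apply: eq_bigr => k _.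
by rewrite (partialZ c _ sf) (partialZ c _ (smooth_partial _ sf)).
Qed.

Lemma laplacian0 : lap 0 = 0.
Proof. by rewrite /laplacian' big1 // => k _; rewrite !partial0. Qed.

Lemma iter_laplacian0 k : iter k lap 0 = 0.
Proof. by elim: k => [|k IH]; rewrite ?iterS ?IH ?laplacian0. Qed.

(** The only place where symmetry of second derivatives is needed. *)
Lemma laplacian_partial f : smooth f ->
  lap (partial xn f) = partial xn (lap f).
Proof.
move=> sf; rewrite /laplacian'.
rewrite (partial_sum (index_enum _) predT); last first.
  by move=> k; exact: smooth_partial _ (smooth_partial _ sf).
apply: eq_bigr => k _.
by rewrite (partialC _ xn sf) (partialC _ xn (smooth_partial _ sf)).
Qed.

Local Opaque laplacian'.

Lemma smooth_iter_partial q f : smooth f -> smooth (iter q (partial xn) f).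
Proof.
by move=> sf; elim: q => [|q IH]; [exact: sf | exact: (smooth_partial xn IH)].
Qed.

Lemma smooth_iter_laplacian k f : smooth f -> smooth (iter k lap f).
Proof.
by move=> sf; elim: k => [|k IH]; [exact: sf | exact: (smooth_laplacian IH)].
Qed.

Lemma iter_partialZ q c f : smooth f ->
  iter q (partial xn) (c *: f) = c *: iter q (partial xn) f.
Proof.
move=> sf; elim: q => [|q IH]; first by [].
by rewrite iterS IH (partialZ c xn (smooth_iter_partial q sf)).
Qed.

Lemma iter_laplacianZ k c f : smooth f ->
  iter k lap (c *: f) = c *: iter k lap f.
Proof.
move=> sf; elim: k => [|k IH]; first by [].
by rewrite iterS IH (laplacianZ c (smooth_iter_laplacian k sf)).
Qed.

Lemma iter_partial_laplacian q f : smooth f ->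
  iter q (partial xn) (lap f) = lap (iter q (partial xn) f).
Proof.
move=> sf; elim: q => [|q IH]; first by [].
rewrite iterS IH; exact: esym (laplacian_partial (smooth_iter_partial q sf)).
Qed.

Lemma gegenbauer_natZ mu l c f : smooth f ->
  gegenbauer_nat mu l (c *: f) = c *: gegenbauer_nat mu l f.
Proof.
move=> sf; rewrite !gegenbauer_natE scaler_sumr; apply: eq_bigr => k _.
rewrite (iter_partialZ _ _ sf) (iter_laplacianZ _ _ (smooth_iter_partial _ sf)).
by rewrite !scalerA mulrC.
Qed.

(** The coefficientwise action of [gegenbauer], including the vanishing negative
    orders. *)
Definition gegenbauer_fun mu (l : int) f : 'rV[R]_n -> R[i] :=
  if l is Posz l then gegenbauer_nat mu l f else 0.

Lemma gegenbauer_funE mu l (w : diffform R n) I :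
  gegenbauer mu l w I = gegenbauer_fun mu l (w I).
Proof. by case: l. Qed.

Lemma gegenbauer_funZ mu l c f : smooth f ->
  gegenbauer_fun mu l (c *: f) = c *: gegenbauer_fun mu l f.
Proof. by case: l => l sf /=; [exact: gegenbauer_natZ | rewrite scaler0]. Qed.

Lemma gegenbauer_fun0 mu l : gegenbauer_fun mu l 0 = 0.
Proof. by have := gegenbauer_funZ mu l 0 (@smooth0 R n); rewrite !scale0r. Qed.

(** Both summands of the three-term recurrence are brought to the monomials
    [Lap ^ k d_n ^ (a - 2 k)] of [D_a^mu]; they contribute the fractions [k] and
    [(a - 2 k) / 2] of its coefficients, which add up to [a / 2]. *)
Lemma gegenbauer_fun_lap mu a f : smooth f ->
  gegenbauer_fun (mu + 1) (a%:Z - 2) (lap f) =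
  \sum_(0 <= k < (a./2).+1) (k%:R * gegen_coef mu a k) *:
     iter k lap (iter (a - k.*2) (partial xn) f).
Proof.
move=> sf; case: a => [|[|a]].
- by rewrite /= big_nat1 mul0r scale0r.
- by rewrite /= big_nat1 mul0r scale0r.
have -> : (a.+2)%:Z - 2 = a%:Z by lia.
rewrite [gegenbauer_fun _ _ _]/= gegenbauer_natE.
rewrite -[a.+2./2]/(a./2.+1) [RHS]big_nat_recl // mul0r scale0r add0r.
apply: eq_big_nat => k /andP[_ ka].
have [r ->] : exists r, a = (k.*2 + r)%N by exists (a - k.*2)%N; lia.
rewrite gegen_coef_up2 doubleS !subSS addKn (iterSr k lap).
by rewrite (iter_partial_laplacian r sf).
Qed.

Lemma gegenbauer_fun_partial mu a f : smooth f ->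
  gamma_coef mu a *: gegenbauer_fun (mu + 1) (a%:Z - 1) (partial xn f) =
  \sum_(0 <= k < (a./2).+1) ((a - k.*2)%:R / 2 * gegen_coef mu a k) *:
     iter k lap (iter (a - k.*2) (partial xn) f).
Proof.
move=> sf; case: a => [|a].
  by rewrite /= big_nat1 mul0r mul0r scale0r scaler0.
have -> : (a.+1)%:Z - 1 = a%:Z by lia.
rewrite [gegenbauer_fun _ _ _]/= gegenbauer_natE.
(* For even order the term with [2 k] equal to the order carries the factor [0]
   and has no counterpart on the left. *)
have -> : \sum_(0 <= k < (a.+1./2).+1)
     (((a.+1 - k.*2)%:R / 2 : R[i]) * gegen_coef mu a.+1 k) *:
     iter k lap (iter (a.+1 - k.*2) (partial xn) f)
  = \sum_(0 <= k < (a./2).+1) ((a.+1 - k.*2)%:R / 2 * gegen_coef mu a.+1 k) *: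
     iter k lap (iter (a.+1 - k.*2) (partial xn) f).
  have [ao|ae] := boolP (odd a).
    have -> : (a.+1./2 = a./2.+1)%N by lia.
    rewrite big_nat_recr //=.
    have -> : (a.+1 - (a./2.+1).*2 = 0)%N by lia.
    by rewrite mul0r mul0r scale0r addr0.
  by have -> : (a.+1./2 = a./2)%N by lia.
rewrite scaler_sumr; apply: eq_big_nat => k /andP[_ ka].
rewrite scalerA -(iterSr _ (partial xn)).
have [r ar] : exists r, a = (k.*2 + r)%N by exists (a - k.*2)%N; lia.
rewrite ar -addnS !addKn -gegen_coef_up1; congr (_ *: _).
by rewrite /gamma_coef oddD odd_double.
Qed.

(** Homogeneous form of the recurrence of renormalized Gegenbauer polynomials
    that lowers the degree and raises the parameter. *)
Lemma gegenbauer_three_term mu a f : smooth f ->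
  gegenbauer_fun (mu + 1) (a%:Z - 2) (lap f)
    + gamma_coef mu a *: gegenbauer_fun (mu + 1) (a%:Z - 1) (partial xn f)
  = (a%:R / 2) *: gegenbauer_fun mu a%:Z f.
Proof.
move=> sf; rewrite (gegenbauer_fun_lap _ _ sf) (gegenbauer_fun_partial _ _ sf).
rewrite [gegenbauer_fun _ _ _]/= gegenbauer_natE -big_split scaler_sumr /=.
apply: eq_big_nat => k /andP[_ ka].
rewrite -scalerDl scalerA -mulrDl; congr ((_ * _) *: _).
have -> : (a = k.*2 + (a - k.*2))%N by lia.
rewrite addKn natrD -muln2 natrM mulrDl mulfK //.
by rewrite pnatr_eq0.
Qed.

End Gegenbauer.

(** * Test functions *)

Section TestFunctions.
Variables (R : realType) (m : nat) (k : 'I_m).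
Local Notation n := m.+1.
Local Notation xn := (ord_max : 'I_n).
Local Notation lap := (@laplacian' R m).

(** [x_k ^ p * x_n ^ q] for a tangential coordinate [x_k]. *)
Definition test_monomial p q : 'rV[R]_n -> R[i] := monomial (lift xn k) xn p q.

Lemma lift_max_neq (j : 'I_m) : lift xn j != xn.
Proof. by rewrite eq_sym neq_lift. Qed.

Lemma smooth_test p q : smooth (test_monomial p q).
Proof. exact: (@smooth_monomial R _ _ _ (lift_max_neq k) _ _). Qed.

Lemma partial_normal_test p q :
  partial xn (test_monomial p q) = q%:R *: test_monomial p q.-1.
Proof.
rewrite /test_monomial (@partial_monomial R _ _ _ (lift_max_neq k)) eqxx.
by rewrite eq_sym (negPf (lift_max_neq k)).
Qed.

Lemma partial_tangential_test p q :
  partial (lift xn k) (test_monomial p q) = p%:R *: test_monomial p.-1 q.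
Proof.
by rewrite /test_monomial (@partial_monomial R _ _ _ (lift_max_neq k)) eqxx.
Qed.

Lemma partial_other_test (j : 'I_m) p q :
  j != k -> partial (lift xn j) (test_monomial p q) = 0.
Proof.
move=> jk; rewrite /test_monomial (@partial_monomial R _ _ _ (lift_max_neq k)).
by rewrite (inj_eq lift_inj) (negPf jk) (negPf (lift_max_neq j)).
Qed.

Lemma partial2_test (j : 'I_m) p q :
  partial (lift xn j) (partial (lift xn j) (test_monomial p q))
  = if j == k then (p * p.-1)%:R *: test_monomial p.-2 q else 0.
Proof.
have [->|jk] := eqVneq j k; last by rewrite partial_other_test // partial0.
rewrite partial_tangential_test (partialZ _ _ (smooth_test _ _)).
by rewrite partial_tangential_test scalerA natrM.
Qed.

Lemma laplacian_test p q :
  lap (test_monomial p q) = (p * p.-1)%:R *: test_monomial p.-2 q.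
Proof.
rewrite /laplacian' (bigD1 k) //= partial2_test eqxx big1 ?addr0 // => j jk.
by rewrite partial2_test (negPf jk).
Qed.

Lemma iter_partial_test j p q :
  iter j (partial xn) (test_monomial p q)
  = (q ^_ j)%:R *: test_monomial p (q - j).
Proof.
elim: j => [|j IH]; first by rewrite ffactn0 scale1r subn0.
rewrite iterS IH (partialZ _ _ (smooth_test _ _)) partial_normal_test scalerA.
by rewrite -natrM -ffactnSr subnS.
Qed.

Lemma iter_laplacian_test j p q :
  iter j lap (test_monomial p q) = (p ^_ j.*2)%:R *: test_monomial (p - j.*2) q.
Proof.
elim: j => [|j IH]; first by rewrite ffactn0 scale1r subn0.
rewrite iterS IH (laplacianZ _ (smooth_test _ _)) laplacian_test scalerA.
by rewrite -natrM mulnA -subnS -!ffactnSr doubleS -subnS.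
Qed.

(** For [q < 2] this is [(2 h)!] times the coefficient of [Lap ^ h d_n ^ q] in
    [D_(2h+q)^mu]. *)
Definition test_value q h : R[i] := 2 ^+ q * (h.*2)`!%:R / h`!%:R.

(** A term [Lap ^ j d_n ^ (2 h + q - 2 j)] with [j < h] differentiates more than
    [q] times in [x_n] and kills the function; the remaining term [j = h] is the
    one whose coefficient is free of [mu], as its product is empty for [q < 2]. *)
Lemma gegenbauer_test mu q h : (q < 2)%N ->
  gegenbauer_fun mu (h.*2 + q)%N%:Z (test_monomial h.*2 q) 0 = test_value q h.
Proof.
move=> q2; rewrite [gegenbauer_fun _ _ _]/= gegenbauer_natE.
have -> : ((h.*2 + q)./2 = h)%N by lia.
rewrite big_nat_recr //= big_nat big1 ?add0r => [|j /andP[_ jh]]; last first.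
  rewrite iter_partial_test ffact_small; last by lia.
  by rewrite scale0r iter_laplacian0 scaler0.
rewrite addKn iter_partial_test (iter_laplacianZ _ _ (smooth_test _ _)).
rewrite subnn iter_laplacian_test subnn !ffactnn gegen_coefE.
have -> : uphalf q = q by case: q q2 => [|[|]].
rewrite big_geq // mulr1 !fctE /test_monomial.
rewrite (@monomial_at0 R _ (lift xn k) xn) /=.
rewrite /GRing.scale/= mulr1 /test_value.
have -> : q`!%:R = 1 :> R[i] by case: q q2 => [|[|]].
by rewrite mulr1 mul1r mulrAC.
Qed.

Lemma test_value_neq0 q h : test_value q h != 0.
Proof.
rewrite /test_value !mulf_neq0 ?invr_eq0 ?factR_neq0 //.
by rewrite expf_neq0 // pnatr_eq0.
Qed.

Lemma test_value1 h : test_value 1 h = 2 * test_value 0 h.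
Proof. by rewrite /test_value expr1 expr0 mul1r mulrA. Qed.

Lemma test_value0S h : h.+1%:R * test_value 0 h.+1
  = (h.+1.*2 * h.+1.*2.-1)%:R * test_value 0 h.
Proof.
rewrite /test_value !expr0 !mul1r doubleS !factS /= !natrM.
have := factR_neq0 R[i] h.
have : h.+1%:R != 0 :> R[i] by rewrite pnatr_eq0.
move: (h.+1%:R : R[i]) => c c0 h0; field.
by rewrite c0 h0.
Qed.

End TestFunctions.

Local Opaque laplacian' gegenbauer_nat.

(** * Forms with a single coefficient *)

Section Forms.
Variables (R : realType) (n : nat).
Implicit Types (w : diffform R n) (I K : {set 'I_n}) (j l : 'I_n)
  (f : 'rV[R]_n -> R[i]).

Lemma codiffE w K : codiff w K = - \sum_(j < n)
  (if j \in K then 0 else wsign R j K *: partial j (w (j |: K))).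
Proof. by rewrite /codiff opprfctE fct_sumE. Qed.

Lemma ext_dE w K : ext_d w K = \sum_(j < n)
  (if j \in K then wsign R j K *: partial j (w (K :\ j)) else 0).
Proof. by rewrite /ext_d fct_sumE. Qed.

Lemma codiff_only w K l : l \notin K ->
  (forall j, j \notin K -> j != l -> w (j |: K) = 0) ->
  codiff w K = - (wsign R l K *: partial l (w (l |: K))).
Proof.
move=> lK w0; rewrite codiffE (bigD1 l) //= (negPf lK) big1 ?addr0 // => j jl.
by case: ifPn => // jK; rewrite w0 // partial0 scaler0.
Qed.

Lemma ext_d_only w K l : l \in K ->
  (forall j, j \in K -> j != l -> w (K :\ j) = 0) ->
  ext_d w K = wsign R l K *: partial l (w (K :\ l)).
Proof.
move=> lK w0; rewrite ext_dE (bigD1 l) //= lK big1 ?addr0 // => j jl.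
by case: ifPn => // jK; rewrite w0 // partial0 scaler0.
Qed.

Lemma wsignD1 j K : wsign R j (K :\ j) = wsign R j K.
Proof.
rewrite /wsign; congr (_ ^+ #|pred_of_set _|); apply/setP => l; rewrite !inE.
by case: (l =P j) => // ->; rewrite ltnn !andbF.
Qed.

Lemma wsignU1 j K : wsign R j (j |: K) = wsign R j K.
Proof.
rewrite /wsign; congr (_ ^+ #|pred_of_set _|); apply/setP => l; rewrite !inE.
by case: (l =P j) => // ->; rewrite ltnn !andbF.
Qed.

Lemma wsign_neq0 j K : wsign R j K != 0.
Proof. by rewrite /wsign signr_eq0. Qed.

Lemma wsign_sq j K : wsign R j K * wsign R j K = 1.
Proof. by rewrite /wsign -expr2 sqrr_sign. Qed.

Definition single K f : diffform R n := fun I => if I == K then f else 0.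

Lemma singleE K f : single K f K = f.
Proof. by rewrite /single eqxx. Qed.

Lemma single_neq K f I : I != K -> single K f I = 0.
Proof. by rewrite /single => /negPf ->. Qed.

Lemma smooth_form_single K f : smooth f -> smooth_form #|K| (single K f).
Proof.
move=> sf; split=> I.
  by rewrite /single; case: ifP => _; [exact: sf | exact: smooth0].
by move=> IK; apply: single_neq; apply: contraNneq IK => ->.
Qed.

Lemma codiff_single K f j : j \in K ->
  codiff (single K f) (K :\ j) = - (wsign R j K *: partial j f).
Proof.
move=> jK; rewrite (@codiff_only _ _ j) ?finset.setD11 //.
  by rewrite finset.setD1K // singleE wsignD1.
move=> l; rewrite !inE negb_and negbK => /orP[-> //|lK] _.
by apply: single_neq; apply: contraNneq lK => <-; rewrite finset.setU11.
Qed.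

Lemma codiff_singleU1 K f j : j \notin K ->
  codiff (single (j |: K) f) K = - (wsign R j K *: partial j f).
Proof.
move=> jK; have := @codiff_single (j |: K) f j.
by rewrite finset.setU11 finset.setU1K // wsignU1 => /(_ isT).
Qed.

(** Removing [dx_j] and inserting it again meets the same sign twice, and only
    the same index [j] can restore the index set. *)
Lemma ext_d_codiff_single K f : smooth f ->
  ext_d (codiff (single K f)) K = - \sum_(j in K) partial j (partial j f).
Proof.
move=> sf; rewrite ext_dE [in RHS]big_mkcond /= -sumrN; apply: eq_bigr => j _.
case: ifPn => jK; last by rewrite oppr0.
rewrite codiff_single // -scaleN1r scalerA.
rewrite (partialZ _ _ (smooth_partial _ sf)) scalerA mulrCA wsign_sq mulr1.
by rewrite scaleN1r.
Qed.

Lemma interior_mul_single K f j : j \notin K ->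
  interior_mul j (single (j |: K) f) = single K (wsign R j K *: f).
Proof.
move=> jK; apply/funext => I; rewrite /interior_mul /single.
have [jI|jI] := boolP (j \in I).
  by have [IK|//] := eqVneq I K; rewrite -IK jI in jK.
have [->|IK] := eqVneq I K; first by rewrite eqxx.
have [E|_] := eqVneq (j |: I) (j |: K); last by rewrite scaler0.
by move: IK; rewrite -(finset.setU1K jI) E (finset.setU1K jK) eqxx.
Qed.

Lemma interior_mul_single0 K f j : j \notin K ->
  interior_mul j (single K f) = 0.
Proof.
move=> jK; apply/funext => I; rewrite /interior_mul.
case: ifP => // _; rewrite single_neq ?scaler0 //.
by apply: contraNneq jK => <-; rewrite finset.setU11.
Qed.

(** The degree condition of [smooth_form] alone: it is preserved by the algebra
    below without smoothness. *)
Definition homogeneous i w := forall I, #|I| != i -> w I = 0.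

Lemma homogeneous_interior i w j :
  homogeneous i.+1 w -> homogeneous i (interior_mul j w).
Proof.
move=> hw K Ki; rewrite /interior_mul; case: ifPn => // jK.
by rewrite hw ?scaler0 // cardsU1 jK.
Qed.

Lemma homogeneous_codiff i w : homogeneous i.+1 w -> homogeneous i (codiff w).
Proof.
move=> hw K Ki; rewrite codiffE big1 ?oppr0 // => j _; case: ifPn => // jK.
by rewrite hw ?partial0 ?scaler0 // cardsU1 jK.
Qed.

Lemma homogeneous_ext_d i w : homogeneous i w -> homogeneous i.+1 (ext_d w).
Proof.
move=> hw K Ki; rewrite ext_dE big1 // => j _; case: ifPn => // jK.
rewrite hw ?partial0 ?scaler0 //.
by apply: contraNneq Ki => <-; rewrite (cardsD1 j K) jK.
Qed.

Lemma interior_mul_function w j : homogeneous 0 w -> interior_mul j w = 0.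
Proof.
move=> hw; apply/funext => K; rewrite /interior_mul; case: ifPn => // jK.
by rewrite hw ?scaler0 // cardsU1 jK.
Qed.

Lemma codiff_function w : homogeneous 0 w -> codiff w = 0.
Proof.
move=> hw; apply/funext => K; rewrite codiffE big1 ?oppr0 // => j _.
by case: ifPn => // jK; rewrite hw ?partial0 ?scaler0 // cardsU1 jK.
Qed.

Lemma ext_d0 : ext_d (0 : diffform R n) = 0.
Proof.
apply/funext => K; rewrite ext_dE big1 // => j _.
by rewrite partial0 scaler0; case: ifP.
Qed.

End Forms.

(** * The operators on single-coefficient forms *)

Section Operators.
Variables (R : realType) (m : nat).
Local Notation n := m.+1.
Local Notation xn := (ord_max : 'I_n).
Implicit Types (J : {set 'I_m}) (f : 'rV[R]_n -> R[i]) (u : R[i]).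

Definition tangential J : {set 'I_n} := [set lift xn k | k in J].

Lemma xn_notin_tangential J : xn \notin tangential J.
Proof. by apply/imsetP => -[k _ /eqP]; rewrite (negPf (neq_lift _ _)). Qed.

Lemma mem_tangential J k : (lift xn k \in tangential J) = (k \in J).
Proof. by rewrite mem_imset //; exact: lift_inj. Qed.

Lemma card_tangential J : #|tangential J| = #|J|.
Proof. by rewrite card_imset //; exact: lift_inj. Qed.

Lemma tangentialU1 J k : tangential (k |: J) = lift xn k |: tangential J.
Proof. by rewrite /tangential imsetU1. Qed.

Lemma sum_tangential J f : \sum_(j in tangential J) partial j (partial j f)
  = \sum_(k in J) partial (lift xn k) (partial (lift xn k) f).
Proof. by rewrite big_imset //=; move=> ? ? _ _; exact: lift_inj. Qed.

Lemma sum_tangential_setT f :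
  \sum_(j in tangential [set: 'I_m]) partial j (partial j f) = laplacian' f.
Proof. by rewrite sum_tangential; apply: eq_bigl => k; rewrite inE. Qed.

Lemma sum_tangential_test J k p q :
  \sum_(j in tangential J) partial j (partial j (test_monomial k p q))
  = (if k \in J then (p * p.-1)%:R else 0) *: test_monomial k p.-2 q
  :> ('rV[R]_n -> R[i]).
Proof.
rewrite sum_tangential; case: ifPn => kJ.
  rewrite (bigD1 k) //= partial2_test eqxx big1 ?addr0 // => j /andP[_ jk].
  by rewrite partial2_test (negPf jk).
rewrite scale0r big1 // => j jJ; rewrite partial2_test.
by case: eqP jJ kJ => // -> ->.
Qed.

Lemma sbo_downE i u a w J y : sbo_down i u a w J y =
  - gegenbauer_fun (mu_of m u i + 1) (a%:Z - 2)
      (ext_d (codiff (interior_mul xn w)) (tangential J)) (hyperplane y)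
  - gamma_coef (mu_of m u i) a * gegenbauer_fun (mu_of m u i + 1) (a%:Z - 1)
      (codiff w (tangential J)) (hyperplane y)
  + (u + 2 * i%:R - n%:R) / 2 * gegenbauer_fun (mu_of m u i) a
      (interior_mul xn w (tangential J)) (hyperplane y).
Proof. by rewrite -!gegenbauer_funE. Qed.

Lemma sbo_sameE i u a w J y : sbo_same i u a w J y =
  gegenbauer_fun (mu_of m u i + 1) (a%:Z - 2)
      (ext_d (codiff w) (tangential J)) (hyperplane y)
  - gamma_coef (mu_of m u i - 1 / 2) a * gegenbauer_fun (mu_of m u i) (a%:Z - 1)
      (ext_d (interior_mul xn w) (tangential J)) (hyperplane y)
  + (u + a%:R) / 2 * gegenbauer_fun (mu_of m u i) a
      (w (tangential J)) (hyperplane y).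
Proof. by rewrite -!gegenbauer_funE. Qed.

(** The form is, up to sign, [f dx_n] wedge a tangential [dx_J]; contraction with
    [d/dx_n] leaves [f dx_J], and the coefficient of [dx_J]
    in the image is read off. *)
Lemma sbo_down_normal i u a f J y : smooth f ->
  sbo_down i u a (single (xn |: tangential J) f) J y = wsign R xn (tangential J) *
  (gegenbauer_fun (mu_of m u i + 1) (a%:Z - 2)
      (\sum_(j in tangential J) partial j (partial j f)) (hyperplane y)
  + gamma_coef (mu_of m u i) a * gegenbauer_fun (mu_of m u i + 1) (a%:Z - 1)
      (partial xn f) (hyperplane y)
  + (u + 2 * i%:R - n%:R) / 2 * gegenbauer_fun (mu_of m u i) a
      f (hyperplane y)).
Proof.
move=> sf; have xJ := xn_notin_tangential J; set s := wsign _ _ _.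
have sS : smooth (\sum_(j in tangential J) partial j (partial j f)).
  apply: (smooth_sum (index_enum _) (mem (tangential J))) => j.
  exact: smooth_partial _ (smooth_partial _ sf).
have E1 : ext_d (codiff (interior_mul xn (single (xn |: tangential J) f)))
      (tangential J)
    = - s *: \sum_(j in tangential J) partial j (partial j f).
  rewrite interior_mul_single // (ext_d_codiff_single _ (smoothZ _ sf)).
  rewrite scaleNr scaler_sumr; congr (- _); apply: eq_bigr => j _.
  by rewrite (partialZ _ _ sf) (partialZ _ _ (smooth_partial _ sf)).
have E2 : codiff (single (xn |: tangential J) f) (tangential J)
    = - s *: partial xn f.
  rewrite codiff_singleU1 //.
  by rewrite scaleNr.
have E3 : interior_mul xn (single (xn |: tangential J) f) (tangential J) = s *: f.
  by rewrite interior_mul_single // singleE.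
rewrite sbo_downE E1 E2 E3.
rewrite (gegenbauer_funZ _ _ _ sS) (gegenbauer_funZ _ _ _ (smooth_partial xn sf)).
rewrite (gegenbauer_funZ _ _ _ sf) !scalrfctE /GRing.scale/=.
ring.
Qed.

(** A tangential form is killed by the contraction with [d/dx_n], so only the
    middle term of the operator survives. *)
Lemma sbo_down_tangential i u a f J k y : smooth f -> k \notin J ->
  sbo_down i u a (single (tangential (k |: J)) f) J y =
  wsign R (lift xn k) (tangential J) * (gamma_coef (mu_of m u i) a *
  gegenbauer_fun (mu_of m u i + 1) (a%:Z - 1) (partial (lift xn k) f)
    (hyperplane y)).
Proof.
move=> sf kJ; have kI : lift xn k \notin tangential J by rewrite mem_tangential.
rewrite sbo_downE (interior_mul_single0 _ (xn_notin_tangential _)).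
have -> : codiff (0 : diffform R n) = 0 by apply: codiff_function.
rewrite ext_d0 !gegenbauer_fun0.
have -> : codiff (single (tangential (k |: J)) f) (tangential J)
    = - wsign R (lift xn k) (tangential J) *: partial (lift xn k) f.
  rewrite tangentialU1 codiff_singleU1 //.
  by rewrite scaleNr.
rewrite (gegenbauer_funZ _ _ _ (smooth_partial _ sf)) !scalrfctE /GRing.scale/=.
rewrite /0 /=; ring.
Qed.

Lemma sbo_same_tangential i u a f J y : smooth f ->
  sbo_same i u a (single (tangential J) f) J y =
  - gegenbauer_fun (mu_of m u i + 1) (a%:Z - 2)
      (\sum_(j in tangential J) partial j (partial j f)) (hyperplane y)
  + (u + a%:R) / 2 * gegenbauer_fun (mu_of m u i) a f (hyperplane y).
Proof.
move=> sf.
have sS : smooth (\sum_(j in tangential J) partial j (partial j f)).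
  apply: (smooth_sum (index_enum _) (mem (tangential J))) => j.
  exact: smooth_partial _ (smooth_partial _ sf).
rewrite sbo_sameE (interior_mul_single0 _ (xn_notin_tangential _)) ext_d0.
rewrite gegenbauer_fun0 singleE (ext_d_codiff_single _ sf) -scaleN1r.
rewrite (gegenbauer_funZ _ _ _ sS) !scalrfctE /GRing.scale/=.
rewrite mulr0 subr0; ring.
Qed.

(** The coefficient of [dx_k] wedge [dx_J], with [k] outside [J]: since
    [dx_n] has to disappear and [dx_k] to appear, [d d*] contributes one single
    mixed derivative. *)
Lemma sbo_same_normal i u a f J k y : smooth f -> k \notin J ->
  sbo_same i u a (single (xn |: tangential J) f) (k |: J) y =
  - (wsign R (lift xn k) (tangential J) * wsign R xn (tangential J)) *
  (gegenbauer_fun (mu_of m u i + 1) (a%:Z - 2)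
      (partial (lift xn k) (partial xn f)) (hyperplane y)
   + gamma_coef (mu_of m u i - 1 / 2) a *
     gegenbauer_fun (mu_of m u i) (a%:Z - 1)
      (partial (lift xn k) f) (hyperplane y)).
Proof.
move=> sf kJ; have kI : lift xn k \notin tangential J by rewrite mem_tangential.
have xJ := xn_notin_tangential J; have xkJ := xn_notin_tangential (k |: J).
set s := wsign R (lift xn k) _; set t := wsign R xn _.
rewrite sbo_sameE [single _ _ (tangential _)]single_neq; last first.
  by apply: contraNneq xkJ => ->; rewrite finset.setU11.
have -> : ext_d (interior_mul xn (single (xn |: tangential J) f))
      (tangential (k |: J))
    = (s * t) *: partial (lift xn k) f.
  rewrite interior_mul_single // tangentialU1.
  rewrite (@ext_d_only _ _ _ _ (lift xn k)) ?finset.setU11 //.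
    rewrite finset.setU1K // singleE wsignU1 -scalerA; congr (_ *: _).
    exact: partialZ.
  move=> j jK jk; apply: single_neq; apply: contraNneq kI => <-.
  by rewrite !inE eq_sym jk eqxx.
have -> : ext_d (codiff (single (xn |: tangential J) f)) (tangential (k |: J))
    = - (s * t) *: partial (lift xn k) (partial xn f).
  rewrite tangentialU1 (@ext_d_only _ _ _ _ (lift xn k)) ?finset.setU11 //.
    rewrite finset.setU1K // codiff_singleU1 // wsignU1 -/s -/t.
    rewrite -scaleNr (partialZ _ _ (smooth_partial _ sf)) scalerA.
    by rewrite mulrN.
  move=> j jK jk; rewrite codiffE big1 ?oppr0 // => l _; case: ifPn => // lK.
  rewrite single_neq ?partial0 ?scaler0 //.
  apply/negP => /eqP/setP/(_ (lift xn k)); rewrite !inE eqxx (eq_sym _ j) jk.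
  by rewrite (negPf kI) (negPf (lift_max_neq k)) orbT.
rewrite gegenbauer_fun0.
rewrite (gegenbauer_funZ _ _ _ (smooth_partial _ sf)).
rewrite (gegenbauer_funZ _ _ _ (smooth_partial _ (smooth_partial _ sf))).
rewrite !scalrfctE /GRing.scale/= mulr0 addr0; ring.
Qed.

End Operators.

(** * Vanishing of the operators *)

Section Vanishing.
Variables (R : realType) (m : nat) (u : R[i]) (a : nat).
Local Notation n := m.+1.
Local Notation xn := (ord_max : 'I_n).
Implicit Types (K : {set 'I_n}) (J : {set 'I_m}) (f : 'rV[R]_n -> R[i])
  (w : diffform R n).

Lemma ex_card_set c : (c <= m)%N -> exists J : {set 'I_m}, #|J| = c.
Proof.
move=> cm; exists [set widen_ord cm x | x : 'I_c].
by rewrite card_imset ?card_ord // => x y /(congr1 val) /= /val_inj.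
Qed.

Lemma ex_notin (J : {set 'I_m}) : (#|J| < m)%N -> exists k, k \notin J.
Proof.
move=> Jm; suff /card_gt0P[k] : (0 < #|~: J|)%N by rewrite inE; exists k.
by rewrite cardsCs finset.setCK card_ord subn_gt0.
Qed.

Lemma hyperplane0 : hyperplane (0 : 'rV[R]_m) = 0.
Proof. by apply/rowP => j; rewrite !mxE; case: unlift => // k; rewrite mxE. Qed.

Lemma tangential_setT : xn |: tangential [set: 'I_m] = [set: 'I_n].
Proof.
apply/setP => j; rewrite !inE; case: (unliftP xn j) => [k ->|->].
  by rewrite mem_tangential inE orbT.
by rewrite eqxx.
Qed.

Definition vanishes_down i :=
  forall w : diffform R n, smooth_form i w -> sbo_down i u a w = 0.
Definition vanishes_same i :=
  forall w : diffform R n, smooth_form i w -> sbo_same i u a w = 0.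

Lemma vanishes_down_single i K f J : vanishes_down i -> #|K| = i -> smooth f ->
  sbo_down i u a (single K f) J 0 = 0.
Proof.
move=> V Ki sf; have sK : smooth_form i (single K f).
  by rewrite -Ki; exact: smooth_form_single.
by rewrite (V _ sK).
Qed.

Lemma vanishes_same_single i K f J : vanishes_same i -> #|K| = i -> smooth f ->
  sbo_same i u a (single K f) J 0 = 0.
Proof.
move=> V Ki sf; have sK : smooth_form i (single K f).
  by rewrite -Ki; exact: smooth_form_single.
by rewrite (V _ sK).
Qed.

Lemma card_normal J : #|xn |: tangential J| = #|J|.+1.
Proof. by rewrite cardsU1 xn_notin_tangential card_tangential. Qed.

Lemma gegenbauer_testZ mu (c : R[i]) (k : 'I_m) q h (l : int) :
  (q < 2)%N -> l = (h.*2 + q)%N%:Z ->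
  gegenbauer_fun mu l (c *: test_monomial k h.*2 q) 0 = c * test_value R q h.
Proof.
move=> q2 ->; rewrite (gegenbauer_funZ _ _ _ (smooth_test _ _ _ _)).
by rewrite -(gegenbauer_test k mu h q2).
Qed.

Lemma gegenbauer_fun_sub2 mu f x : gegenbauer_fun mu (0%:Z - 2) f x = 0.
Proof. by []. Qed.

Lemma gegenbauer_fun_sub1 mu f x : gegenbauer_fun mu (0%:Z - 1) f x = 0.
Proof. by []. Qed.

Lemma gegenbauer_power mu (k : 'I_m) l h : l = h.*2 ->
  gegenbauer_fun mu l%:Z (test_monomial k l 0) 0 = test_value R 0 h.
Proof. by move=> ->; rewrite -(@gegenbauer_test R m k mu 0 h) // addn0. Qed.

Lemma wsign_reg (j : 'I_n) K (c : R[i]) : wsign R j K * c = 0 -> c = 0.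
Proof. by move/eqP; rewrite mulf_eq0 (negPf (wsign_neq0 R j K)) => /eqP. Qed.

Lemma test_value_reg q h (c : R[i]) : c * test_value R q h = 0 -> c = 0.
Proof.
have := test_value_neq0 R q h; move: (test_value R q h) => t t0 /eqP.
by rewrite mulf_eq0 (negPf t0) orbF => /eqP.
Qed.

Lemma half_reg (c : R[i]) : c / 2 = 0 -> c = 0.
Proof. by move/eqP; rewrite mulf_eq0 invr_eq0 pnatr_eq0 orbF => /eqP. Qed.

Lemma natmul_reg c (d : R[i]) : (0 < c)%N -> d * c%:R = 0 -> d = 0.
Proof.
by move=> c0 /eqP; rewrite mulf_eq0 pnatr_eq0 (gtn_eqF c0) orbF => /eqP.
Qed.

Lemma order_parity : exists q h, (q < 2)%N /\ a = (h.*2 + q)%N.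
Proof. by exists (odd a : nat), a./2; split; lia. Qed.

(** In top degree the sum of the second derivatives runs over all tangential
    coordinates, so that the three-term recurrence applies. *)
Lemma sbo_down_volume f y : smooth f ->
  sbo_down n u a (single [set: 'I_n] f) [set: 'I_m] y =
  wsign R xn (tangential [set: 'I_m]) * ((u + n%:R + a%:R) / 2 *
    gegenbauer_fun (mu_of m u n) a f (hyperplane y)).
Proof.
move=> sf; rewrite -tangential_setT (sbo_down_normal _ _ _ _ _ sf).
rewrite sum_tangential_setT.
congr (_ * _).
have /(congr1 (@^~ (hyperplane y))) := gegenbauer_three_term (mu_of m u n) a sf.
rewrite !fctE /GRing.scale /= => ->.
move: (gegenbauer_nat _ _ _ _) => g.
by field.
Qed.

Lemma vanishes_down_order0_inv i : a = 0%N -> (i <= m)%N -> (0 < m)%N ->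
  vanishes_down i.+1 -> u = n%:R - 2 * i.+1%:R.
Proof.
move=> a0 im m0 V.
have [J Ji] := ex_card_set im.
pose k := Ordinal m0.
have := @vanishes_down_single _ (xn |: tangential J) (test_monomial k 0 0) J V.
rewrite card_normal Ji => /(_ erefl (smooth_test _ _ _ _)).
rewrite (sbo_down_normal _ _ _ _ _ (smooth_test _ _ _ _)) hyperplane0 a0.
have := @gegenbauer_test R m k (mu_of m u i.+1) 0 0 isT; rewrite addn0 => ->.
rewrite gegenbauer_fun_sub2 gegenbauer_fun_sub1 mulr0 !add0r.
move=> /wsign_reg /test_value_reg /half_reg E.
by rewrite -[LHS]subr0 -E; ring.
Qed.

Lemma vanishes_down_volume_inv :
  (0 < m)%N -> vanishes_down n -> u = - n%:R - a%:R.
Proof.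
move=> m0 V; pose k := Ordinal m0.
have [q [h [q2 ah]]] := order_parity.
have := @vanishes_down_single _ [set: 'I_n] (test_monomial k h.*2 q)
  [set: 'I_m] V.
rewrite cardsT card_ord => /(_ erefl (smooth_test _ _ _ _)).
rewrite (sbo_down_volume _ (smooth_test _ _ _ _)) hyperplane0 ah.
rewrite (gegenbauer_test k _ _ q2) => /wsign_reg /test_value_reg /half_reg E.
by rewrite -[LHS]subr0 -E; ring.
Qed.

(** A tangential form [f dx_I] forces [gamma_coef mu a = 0], hence [a] even and
    [mu = - a / 2], and the middle term disappears. On [f dx_n dx_J] a function of
    some [x_k] with [k] outside [J] then forces [u + 2 i - n = 0], and a
    function of some [x_l] with [l] in [J] isolates the nonzero first term. When
    [J] is empty there is no such [l], but the two equations for [u] found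
    before are already incompatible, as they give [m + a = 0]. *)
Lemma nonvanishing_down i : (0 < a)%N -> (i < m)%N -> ~ vanishes_down i.+1.
Proof.
move=> a0 im V.
have [J Ji] := ex_card_set (ltnW im).
have [k kJ] : exists k, k \notin J by apply: ex_notin; rewrite Ji.
have mu0 : gamma_coef (mu_of m u i.+1) a = 0.
  have [q [h [q2 ah]]] : exists q h, (q < 2)%N /\ a = (h.*2 + q).+1%N.
    by exists (odd a.-1 : nat), a.-1./2; split; lia.
  have := @vanishes_down_single _ (tangential (k |: J))
    (test_monomial k h.*2.+1 q) J V.
  rewrite card_tangential cardsU1 kJ Ji => /(_ erefl (smooth_test _ _ _ _)).
  rewrite (sbo_down_tangential _ _ _ _ (smooth_test _ _ _ _) kJ) hyperplane0.
  rewrite partial_tangential_test (@gegenbauer_testZ _ _ k q h) //; last first.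
    by rewrite ah; lia.
  by move/wsign_reg; rewrite mulrA => /test_value_reg; exact: natmul_reg.
have ae : ~~ odd a.
  by apply/negP => ao; move/eqP: mu0; rewrite /gamma_coef ao oner_eq0.
have [h ah] : exists h, a = (h.+1.*2)%N by exists a./2.-1; lia.
have eq_normal l : (if l \in J then (a * a.-1)%:R * test_value R 0 h else 0)
    + (u + 2 * i.+1%:R - n%:R) / 2 * test_value R 0 h.+1 = 0.
  have := @vanishes_down_single _ (xn |: tangential J) (test_monomial l a 0) J V.
  rewrite card_normal Ji => /(_ erefl (smooth_test _ _ _ _)).
  rewrite (sbo_down_normal _ _ _ _ _ (smooth_test _ _ _ _)) hyperplane0.
  rewrite mu0 mul0r addr0 sum_tangential_test.
  rewrite (gegenbauer_power _ _ ah).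
  have -> : a.-2 = h.*2 by rewrite ah.
  rewrite (@gegenbauer_testZ _ _ l 0 h) //; last by rewrite ah; lia.
  by move/wsign_reg; case: ifP; rewrite ?mul0r.
have u0 : u + 2 * i.+1%:R - n%:R = 0.
  by have := eq_normal k; rewrite (negPf kJ) add0r => /test_value_reg /half_reg.
case: (posnP i) => [i0|i_gt0]; last first.
  have [l lJ] : exists l, l \in J by apply/card_gt0P; rewrite Ji.
  have := eq_normal l; rewrite lJ u0 !mul0r addr0 => /test_value_reg /eqP.
  by rewrite pnatr_eq0 ah.
move: mu0 u0; rewrite /gamma_coef (negPf ae) /mu_of i0 => mu0 u0.
suff : (m + a)%:R = 0 :> R[i].
  by apply/eqP; rewrite pnatr_eq0 addn_eq0 (gtn_eqF a0) andbF.
apply: etrans (_ : 2 * (u + 1 - (n%:R - 1) / 2 + a%:R / 2)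
  - 2 * (u + 2 * 1 - n%:R) = 0).
  by rewrite natrD -[n%:R]natr1; field.
by rewrite mu0 u0 !mulr0 subr0.
Qed.

Lemma vanishes_same_order0_inv i : a = 0%N -> (i <= m)%N -> (0 < m)%N ->
  vanishes_same i -> u = 0.
Proof.
move=> a0 im m0 V.
have [J Ji] := ex_card_set im.
pose k := Ordinal m0.
have := @vanishes_same_single _ (tangential J) (test_monomial k 0 0) J V.
rewrite card_tangential Ji => /(_ erefl (smooth_test _ _ _ _)).
rewrite (sbo_same_tangential _ _ _ _ _ (smooth_test _ _ _ _)) hyperplane0 a0.
have := @gegenbauer_test R m k (mu_of m u i) 0 0 isT; rewrite addn0 => ->.
by rewrite gegenbauer_fun_sub2 oppr0 add0r addr0 => /test_value_reg /half_reg.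
Qed.

Lemma vanishes_same_functions_inv : (0 < m)%N -> vanishes_same 0 -> u = - a%:R.
Proof.
move=> m0 V; pose k := Ordinal m0.
have [q [h [q2 ah]]] := order_parity.
have := @vanishes_same_single _ (tangential finset.set0)
  (test_monomial k h.*2 q) finset.set0 V.
rewrite card_tangential cards0 => /(_ erefl (smooth_test _ _ _ _)).
rewrite (sbo_same_tangential _ _ _ _ _ (smooth_test _ _ _ _)) hyperplane0.
rewrite sum_tangential big_set0 gegenbauer_fun0 oppr0 add0r ah.
rewrite (gegenbauer_test k _ _ q2) => /test_value_reg /half_reg /eqP.
by rewrite addr_eq0 => /eqP.
Qed.

(** The mixed coefficient in [sbo_same_normal] excludes odd [a], and gives
    [2 mu + a = 0] for even [a]. On a tangential [f dx_K], powers of [x_k] with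
    [k] in [K] give [u = 0], and powers of [x_l] with [l] outside [K] give
    [u = - a]. When [K] is everything there is no such [l], but [u = 0] then
    contradicts [2 mu + a = 0], since [2 mu = m]. *)
Lemma nonvanishing_same i : (0 < a)%N -> (i < m)%N -> ~ vanishes_same i.+1.
Proof.
move=> a0 im V.
have [J Ji] := ex_card_set (ltnW im).
have [k kJ] : exists k, k \notin J by apply: ex_notin; rewrite Ji.
have eq_normal f : smooth f -> gegenbauer_fun (mu_of m u i.+1 + 1) (a%:Z - 2)
      (partial (lift xn k) (partial xn f)) 0
   + gamma_coef (mu_of m u i.+1 - 1 / 2) a *
     gegenbauer_fun (mu_of m u i.+1) (a%:Z - 1) (partial (lift xn k) f) 0 = 0.
  move=> sf; have := @vanishes_same_single _ (xn |: tangential J) f (k |: J) V.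
  rewrite card_normal Ji => /(_ erefl sf).
  rewrite (sbo_same_normal _ _ _ _ sf kJ) hyperplane0 mulNr => /eqP.
  by rewrite oppr_eq0 -mulrA => /eqP /wsign_reg /wsign_reg.
have ae : ~~ odd a.
  apply/negP => ao.
  have [h ah] : exists h, a = h.*2.+1 by exists a./2; lia.
  have := eq_normal _ (smooth_test _ k a 0).
  rewrite partial_normal_test scale0r partial0 gegenbauer_fun0 add0r.
  rewrite partial_tangential_test.
  have -> : a.-1 = h.*2 by rewrite ah.
  rewrite (@gegenbauer_testZ _ _ k 0 h) //; last by rewrite ah; lia.
  rewrite /gamma_coef ao mul1r => /test_value_reg /eqP.
  by rewrite pnatr_eq0 ah.
have [h ah] : exists h, a = (h.+1.*2)%N by exists a./2.-1; lia.
have mu0 : 2 * mu_of m u i.+1 + a%:R = 0.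
  have := eq_normal _ (smooth_test _ k h.*2.+1 1).
  rewrite partial_normal_test scale1r !partial_tangential_test.
  rewrite (@gegenbauer_testZ _ _ k 0 h) //; last by rewrite ah; lia.
  rewrite (@gegenbauer_testZ _ _ k 1 h) //; last by rewrite ah; lia.
  rewrite test_value1 /gamma_coef (negPf ae).
  have -> : forall c t mu : R[i], c * t + (mu - 1 / 2 + a%:R / 2) * (c * (2 * t))
    = (2 * mu + a%:R) * c * t by move=> c t mu; field.
  by move/test_value_reg; exact: natmul_reg.
have Ki : #|k |: J| = i.+1 by rewrite cardsU1 kJ Ji.
have eq_tangential l :
    - (if l \in k |: J then (a * a.-1)%:R * test_value R 0 h else 0)
    + (u + a%:R) / 2 * test_value R 0 h.+1 = 0.
  have := @vanishes_same_single _ (tangential (k |: J)) (test_monomial l a 0)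
    (k |: J) V.
  rewrite card_tangential Ki => /(_ erefl (smooth_test _ _ _ _)).
  rewrite (sbo_same_tangential _ _ _ _ _ (smooth_test _ _ _ _)) hyperplane0.
  rewrite sum_tangential_test (gegenbauer_power _ _ ah).
  have -> : a.-2 = h.*2 by rewrite ah.
  rewrite (@gegenbauer_testZ _ _ l 0 h) //; last by rewrite ah; lia.
  by case: ifP; rewrite ?mul0r.
have u0 : u = 0.
  have := eq_tangential k; rewrite finset.setU11 {1 2}ah -test_value0S.
  have -> : forall t : R[i], - (h.+1%:R * t) + (u + a%:R) / 2 * t = u / 2 * t.
    by move=> t; rewrite ah -muln2 natrM; field.
  by move=> /test_value_reg /half_reg.
have aR : a%:R != 0 :> R[i] by rewrite pnatr_eq0 -lt0n.
have [im'|mi] := ltnP i.+1 m.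
  have [l lK] : exists l, l \notin k |: J by apply: ex_notin; rewrite Ki.
  have := eq_tangential l; rewrite (negPf lK) oppr0 add0r u0 add0r.
  by move=> /test_value_reg /half_reg /eqP; rewrite (negPf aR).
have mE : m = i.+1 by lia.
suff : (m + a)%:R = 0 :> R[i].
  by apply/eqP; rewrite pnatr_eq0 addn_eq0 (gtn_eqF a0) andbF.
by rewrite -mu0 /mu_of u0 -mE natrD -[n%:R]natr1; field.
Qed.

(** Deals with the coefficients of the image that are excluded by degree. *)
Lemma homogeneous_sbo_down i w J : (0 < i)%N ->
  homogeneous i.+1 w -> #|J| != i -> sbo_down i.+1 u a w J = 0.
Proof.
case: i => // i _ hw Ji; have hv := homogeneous_interior xn hw.
apply/funext => y; rewrite sbo_downE.
have Ki : #|tangential J| != i.+1 by rewrite card_tangential.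
rewrite (homogeneous_ext_d (homogeneous_codiff hv) Ki).
rewrite (homogeneous_codiff hw Ki) (hv _ Ki) !gegenbauer_fun0.
by rewrite [X in - X]/= [X in _ * X]/= oppr0 !mulr0 subr0 addr0.
Qed.

Lemma vanishes_down_order0 i : u = n%:R - 2 * i%:R -> a = 0%N ->
  vanishes_down i.
Proof.
move=> uE a0 w sw; apply/funext => J; apply/funext => y; rewrite sbo_downE.
rewrite a0 uE subrK subrr !mul0r addr0 gegenbauer_fun_sub2 gegenbauer_fun_sub1.
by rewrite mulr0 subr0; exact: oppr0.
Qed.

Lemma vanishes_down_volume : (0 < m)%N -> u = - n%:R - a%:R ->
  vanishes_down n.
Proof.
move=> m0 uE w [sw hw].
apply/funext => J; have [->|JT] := eqVneq J [set: 'I_m]; last first.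
  apply: (homogeneous_sbo_down m0 hw).
  apply: contra JT => /eqP Jm.
  by rewrite eqEcard finset.subsetT cardsT card_ord Jm leqnn.
have wE : w = single [set: 'I_n] (w [set: 'I_n]).
  apply/funext => K; rewrite /single; case: eqP => [-> //|/eqP KT].
  apply: hw; apply: contra KT => /eqP Kn.
  by rewrite eqEcard finset.subsetT cardsT card_ord Kn leqnn.
apply/funext => y; rewrite wE (sbo_down_volume _ (sw _)) uE.
by rewrite addrAC subrK addNr !mul0r mulr0.
Qed.

Lemma vanishes_same_order0 i : u = 0 -> a = 0%N -> vanishes_same i.
Proof.
move=> uE a0 w sw; apply/funext => J; apply/funext => y; rewrite sbo_sameE.
have -> : u + a%:R = 0 by rewrite uE a0 addr0.
rewrite !mul0r addr0 a0 gegenbauer_fun_sub2 gegenbauer_fun_sub1.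
by rewrite mulr0 subr0.
Qed.

Lemma vanishes_same_functions : u = - a%:R -> vanishes_same 0.
Proof.
move=> uE w [sw hw]; apply/funext => J; apply/funext => y; rewrite sbo_sameE.
rewrite (codiff_function hw) (interior_mul_function xn hw) ext_d0.
rewrite !gegenbauer_fun0 uE addNr !mul0r addr0.
by rewrite mulr0 subr0.
Qed.

End Vanishing.

Theorem proposition1p4 (R : realType) (m : nat) (u : R[i]) (a : nat) :
  let n := m.+1 in
  (2 <= n)%N ->
  (forall i : nat, (1 <= i <= n)%N ->
     (forall w : diffform R n, smooth_form i w -> sbo_down i u a w = 0) <->
     (u = n%:R - 2 * i%:R /\ a = 0%N) \/ (u = - n%:R - a%:R /\ i = n)) /\
  (forall i : nat, (0 <= i <= n - 1)%N ->
     (forall w : diffform R n, smooth_form i w -> sbo_same i u a w = 0) <->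
     (u = 0 /\ a = 0%N) \/ (u = - a%:R /\ i = 0%N)).
Proof.
move=> n; rewrite ltnS => m0; split=> i.
  case: i => // i /andP[_]; rewrite [(i < n)%N]ltnS => im; split; last first.
    by case=> [[uE a0]|[uE ->]];
      [exact: vanishes_down_order0 | exact: vanishes_down_volume].
  move=> V; have [a0|apos] := posnP a.
    by left; split=> //; exact: (vanishes_down_order0_inv a0 im m0 V).
  move: im; rewrite leq_eqVlt => /orP[/eqP im|im].
    rewrite im in V *; right; split=> //; exact: (vanishes_down_volume_inv m0 V).
  by case: (nonvanishing_down apos im V).
rewrite subn1 /= => im; split; last first.
  by case=> [[uE a0]|[uE ->]];
    [exact: vanishes_same_order0 | exact: vanishes_same_functions].
move=> V; have [a0|apos] := posnP a.
  by left; split=> //; exact: (vanishes_same_order0_inv a0 im m0 V).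
case: i im V => [_|i im] V; last by case: (nonvanishing_same apos im V).
by right; split=> //; exact: (vanishes_same_functions_inv m0 V).
Qed.
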